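(* Let $q$ be a power of an odd prime and let $a,b\in\mathbb{F}_q^{\times}$. Set $\lambda=a^2/b$ and assume that $\lambda\notin\{0,-1\}$. For $\mu\in\mathbb{F}_q\setminus\{0,-1\}$ let $a_q(\mu)$ be the trace of the Frobenius of the elliptic curve over $\mathbb{F}_q$ described by $y^2=(x-1)(x^2+\mu)$. Then $$\psi_{(2,4)}(a,b):=\sum_{x\in\mathbb{F}_q}\phi(x^2+a)\phi(x^4+b)=-\phi(-b)\,a_q(\lambda)-\phi(-a)\,a_q(1/\lambda)-1.$$
   Context: $\phi$ is the quadratic character of $\mathbb{F}_q$, with $\phi(0)=0$. For an elliptic curve $E$ over $\mathbb{F}_q$ the trace of the Frobenius is $1+q-|E(\mathbb{F}_q)|$; in particular, for the curve $y^2=(x-1)(x^2+\mu)$ it equals $a_q(\mu)=-\sum_{x\in\mathbb{F}_q}\phi(x-1)\phi(x^2+\mu)$. *)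

(* Defs.v *)
From mathcomp Require Import all_boot all_order all_algebra all_field.

Set Implicit Arguments.
Unset Strict Implicit.
Unset Printing Implicit Defensive.

Import GRing.Theory.
Local Open Scope ring_scope.

Section Defs.

Variable F : finFieldType.

Definition phi (x : F) : int :=
  if x == 0 then 0 else if [exists y : F, y ^+ 2 == x] then 1 else -1.

(* F-rational points of the projective curve y^2 = f(x), f a monic cubic:
   [Some (x, y)] is an affine point, [None] the unique point at infinity. *)
Definition curve_points (f : {poly F}) : {set option (F * F)} :=
  [set P | if P is Some (x, y) then y ^+ 2 == f.[x] else true].

Definition frob_trace (f : {poly F}) : int :=
  1 + #|F|%:Z - #|curve_points f|%:Z.

Definition cubic (mu : F) : {poly F} := ('X - 1%:P) * ('X^2 + mu%:P).

(* Total in mu; meaningful when y^2 = (x - 1)(x^2 + mu) is an elliptic curve,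
   see [cubic_elliptic]. *)
Definition a_q (mu : F) : int := frob_trace (cubic mu).

Definition psi24 (a b : F) : int :=
  \sum_(x : F) phi (x ^+ 2 + a) * phi (x ^+ 4 + b).

Lemma cubic_elliptic (mu : F) : (2%:R : F) != 0 -> mu != 0 -> mu != -1 ->
  [/\ cubic mu \is monic, size (cubic mu) = 4%N & separable_poly (cubic mu)].
Proof.
move=> h2 mu0 mu1.
have s2 : size ('X^2 + mu%:P : {poly F}) = 3%N.
  by rewrite size_polyDl size_polyXn // size_polyC; case: (mu == 0).
have m2 : ('X^2 + mu%:P : {poly F}) \is monic.
  rewrite monicE lead_coefDl ?lead_coefXn // size_polyXn size_polyC.
  by case: (mu == 0).
split.
- by rewrite monicMl ?monicXsubC.
- by rewrite size_monicM ?monicXsubC ?monic_neq0 // size_XsubC s2.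
rewrite separable_mul separable_poly.unlock derivXsubC coprimep1 /=.
apply/andP; split.
  rewrite derivD derivXn derivC addr0 -mulr_natl -polyC_natr mul_polyC.
  rewrite coprimepZr // -['X^1]subr0 coprimep_XsubC.
  by rewrite rootE !hornerE expr0n /= add0r.
by rewrite coprimep_sym coprimep_XsubC rootE !hornerE expr1n addrC addr_eq0.
Qed.

End Defs.

(* Main.v *)
Require Import Defs.
From mathcomp Require Import all_boot all_order all_algebra all_field.
From mathcomp Require Import fingroup cyclic ring.
Import GRing.Theory.
Local Open Scope ring_scope.

(** Collecting the terms of [psi24 a b] according to the value [u] of [x ^+ 2],
    each nonzero square having two roots, gives
      [\sum_u (1 + phi u) * phi (u + a) * phi (u ^+ 2 + b)].
    Both halves of this sum are cubic character sums in disguise.  In the first,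
    [\sum_u phi (u + a) * phi (u ^+ 2 + b)], scaling [u] by [- a] moves the
    linear root to [1] and pulls out the factor [phi (- a)], the other factor
    [a ^+ 2] being a square.  The second carries an extra [phi u], hence comes
    from a quartic with the rational root [0]; the inversion [u = v^-1] sends
    that root to infinity and leaves
      [\sum_(v != 0) phi (1 + a * v) * phi (1 + b * v ^+ 2)].
    The summation misses [v = 0], whose term is [1]: this is the origin of the
    constant [-1]; the full sum is again rescaled to the standard cubic.
    The same count of square roots turns the trace of Frobenius, defined by
    counting points, into a character sum ([a_qE]).  Everything else rests on
    the multiplicativity of [phi] ([phiM]). *)

Section QuadraticCharacter.

Variable F : finFieldType.
Implicit Types x y c : F.

Lemma phi0 : phi (0 : F) = 0.
Proof. by rewrite /phi eqxx. Qed.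

Lemma phi_sqr x : x != 0 -> phi (x ^+ 2) = 1.
Proof.
move=> x0; rewrite /phi expf_eq0 /= (negPf x0).
by case: existsP => // -[]; exists x.
Qed.

Lemma phi1 : phi (1 : F) = 1.
Proof. by rewrite -(expr1n F 2) phi_sqr ?oner_eq0. Qed.

Lemma phiMsqr x y : y != 0 -> phi (x * y ^+ 2) = phi x.
Proof.
move=> y0; have y20 : y ^+ 2 != 0 by rewrite expf_neq0.
rewrite /phi mulf_eq0 (negPf y20) orbF.
case: eqP => // _; congr (if _ then _ else _).
apply/existsP/existsP => -[z /eqP zE].
  by exists (z / y); rewrite expr_div_n zE mulfK.
by exists (z * y); rewrite exprMn zE.
Qed.

Variant phi_spec c : bool -> int -> Prop :=
| PhiZero of c = 0 : phi_spec c true 0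
| PhiSquare y of c = y ^+ 2 & y != 0 : phi_spec c false 1
| PhiNonsquare of c != 0 & (forall y, y ^+ 2 != c) : phi_spec c false (-1).

Lemma phiP c : phi_spec c (c == 0) (phi c).
Proof.
rewrite /phi; case: eqP => [|/eqP c0]; first exact: PhiZero.
case: existsP => [[y /eqP yE]|nsq].
  apply: (@PhiSquare _ y) => //.
  by apply: contraNneq c0 => y0; rewrite -yE y0 expr0n.
by apply: PhiNonsquare => // y; apply/negP => yE; case: nsq; exists y.
Qed.

(** The unit group is cyclic, and a nonsquare is an odd power of a generator;
    the exponents of two nonsquares thus add up to an even number. *)
Lemma nonsquareM x y : x != 0 -> y != 0 ->
    (forall z, z ^+ 2 != x) -> (forall z, z ^+ 2 != y) ->
  exists2 z, z != 0 & x * y = z ^+ 2.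
Proof.
move=> x0 y0 nsqx nsqy.
have /cyclicP[g gE] := field_unit_group_cyclic [set: {unit F}]%G.
have odd_power c : c != 0 -> (forall z, z ^+ 2 != c) ->
    exists i, c = val g ^+ (i.*2.+1).
  rewrite -unitfE => cU nsqc.
  have /cycleP[i iE] : FinRing.unit F cU \in <[g]>%g by rewrite -gE inE.
  have {iE}cE : c = val g ^+ i by rewrite -FinRing.val_unitX -iE.
  case: (boolP (odd i)) => oi; last first.
    have := nsqc (val g ^+ i./2).
    by rewrite -exprM muln2 cE -[in X in _ != X](even_halfK oi) eqxx.
  by exists i./2; rewrite odd_halfK // prednK // odd_gt0.
have [i xE] := odd_power x x0 nsqx; have [j yE] := odd_power y y0 nsqy.
exists (val g ^+ (i + j).+1).
  by rewrite expf_neq0 // -unitfE (valP g).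
rewrite xE yE -exprD -exprM; congr (_ ^+ _).
by rewrite addnS addSn muln2 doubleS doubleD.
Qed.

Lemma phiM x y : phi (x * y) = phi x * phi y.
Proof.
case: (phiP y) => [-> | z -> z0 | y0 nsqy].
- by rewrite !mulr0 phi0.
- by rewrite mulr1 phiMsqr.
case: (phiP x) => [-> | z -> z0 | x0 nsqx].
- by rewrite !mul0r phi0.
- rewrite mulrC phiMsqr // mul1r.
  by case: (phiP y) y0 nsqy => [->|z' -> _ _ /(_ z')|]; rewrite ?eqxx.
have [z z0 ->] := nonsquareM _ _ x0 y0 nsqx nsqy.
by rewrite phi_sqr.
Qed.

End QuadraticCharacter.

Section CharacterSums.

Variable F : finFieldType.
Hypothesis two_neq0 : (2%:R : F) != 0.

(** The link between [phi] and point counts; in odd characteristic the roots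
    [z] and [- z] of a nonzero square are distinct. *)
Lemma card_sqrt (c : F) : #|[set y : F | y ^+ 2 == c]|%:Z = 1 + phi c.
Proof.
case: phiP => [-> | z -> z0 | c0 nsq].
- rewrite addr0 -[RHS]/(1%:Z) -(cards1 (0 : F)); congr (Posz #|pred_of_set _|).
  by apply/setP => y; rewrite !inE expf_eq0.
- have -> : [set y : F | y ^+ 2 == z ^+ 2] = [set z; - z].
    by apply/setP => y; rewrite !inE eqf_sqr.
  by rewrite cards2 -addr_eq0 -mulr2n -mulr_natl mulf_neq0.
rewrite subrr; congr Posz; apply/eqP; rewrite cards_eq0.
by apply/eqP/setP => y; rewrite !inE (negPf (nsq y)).
Qed.

Lemma sum_sqr (G : F -> int) :
  \sum_x G (x ^+ 2) = \sum_u (1 + phi u) * G u.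
Proof.
rewrite (partition_big (fun x : F => x ^+ 2) xpredT) //=.
apply: eq_bigr => u _; rewrite -card_sqrt.
rewrite (eq_bigr (fun=> G u)) => [|x /eqP-> //].
by rewrite sumr_const -mulr_natl cardsE natz.
Qed.

Lemma frob_traceE (f : {poly F}) : frob_trace f = - \sum_x phi f.[x].
Proof.
rewrite /frob_trace.
suff -> : #|curve_points f|%:Z = 1 + \sum_x (1 + phi f.[x]).
  by rewrite big_split /= sumr_const natz; ring.
pose A := [set P : F * F | P.2 ^+ 2 == f.[P.1]].
have -> : curve_points f = None |: Some @: A.
  apply/setP => -[P|]; rewrite !inE //= mem_imset ?inE; last exact: Some_inj.
  by case: P.
have -> : #|None |: Some @: A| = #|A|.+1.
  rewrite cardsU1 card_imset; last exact: Some_inj.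
  by case: imsetP => [[]|].
rewrite -add1n PoszD; congr (_ + _).
have -> : #|A| = (\sum_x \sum_y ((x, y) \in A))%N.
  by rewrite pair_bigA -sum1_card big_mkcond; apply: eq_bigr => -[x y].
rewrite -natz natr_sum; apply: eq_bigr => x _.
rewrite -card_sqrt -sum1_card natz [in RHS]big_mkcond /=; congr Posz.
by apply: eq_bigr => y _; rewrite !inE.
Qed.

Lemma a_qE (mu : F) : a_q mu = - \sum_x phi (x - 1) * phi (x ^+ 2 + mu).
Proof.
rewrite /a_q frob_traceE; congr (- _); apply: eq_bigr => x _.
by rewrite !hornerE phiM.
Qed.

Variables a b : F.
Hypotheses (a_neq0 : a != 0) (b_neq0 : b != 0).

(** The substitution [u = - a * t] gives the quadratic factor the value
    [a ^+ 2 * (t ^+ 2 + b / a ^+ 2)], whose square coefficient [phi] ignores. *)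
Lemma sum_cubic :
  \sum_u phi (u + a) * phi (u ^+ 2 + b) = - phi (- a) * a_q (b / a ^+ 2).
Proof.
rewrite a_qE mulrNN (reindex_inj (mulfI (_ : - a != 0))) ?oppr_eq0 //=.
rewrite mulr_sumr; apply: eq_bigr => t _.
by rewrite -!phiM -[RHS](phiMsqr _ _ a) //; congr phi; field.
Qed.

(** After the inversion [u = v^-1] has removed the factor [phi u], the
    substitution [v = - t / a] yields the cubic, with leading coefficient
    [- b / a ^+ 2], which contributes [phi (- b)]. *)
Lemma sum_quartic :
  \sum_u phi u * (phi (u + a) * phi (u ^+ 2 + b)) =
    - phi (- b) * a_q (a ^+ 2 / b) - 1.
Proof.
pose G v := phi (1 + a * v) * phi (1 + b * v ^+ 2).
have -> : \sum_u phi u * (phi (u + a) * phi (u ^+ 2 + b)) = \sum_(v | v != 0) G v.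
  rewrite (bigD1 0) //= phi0 mul0r add0r (reindex_inj invr_inj) /=.
  rewrite (eq_bigl (fun v => v != 0)) => [|v]; last by rewrite invr_eq0.
  apply: eq_bigr => v v0; rewrite /G -!phiM.
  (* [v * v * v ^+ 2] clears the denominators of the three factors. *)
  by rewrite -[LHS](phiMsqr _ _ (v ^+ 2)) ?expf_neq0 //; congr phi; field.
have G0 : G 0 = 1 by rewrite /G !mulr0 expr0n mulr0 addr0 phi1.
have -> : \sum_(v | v != 0) G v = \sum_v G v - 1.
  by rewrite [in RHS](bigD1 0) //= G0 addrAC subrr add0r.
congr (_ - _); rewrite a_qE mulrNN.
rewrite (reindex_inj (mulfI (_ : - a^-1 != 0))) ?oppr_eq0 ?invr_eq0 //=.
rewrite mulr_sumr.
apply: eq_bigr => t _; rewrite /G -!phiM -[LHS](phiMsqr _ _ a) //.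
by congr phi; field; apply/andP.
Qed.

Lemma psi24E :
  psi24 a b =
    - phi (- b) * a_q (a ^+ 2 / b) - phi (- a) * a_q (b / a ^+ 2) - 1.
Proof.
pose G u := phi (u + a) * phi (u ^+ 2 + b).
have -> : psi24 a b = \sum_x G (x ^+ 2).
  by apply: eq_bigr => x _; rewrite /G -exprM.
rewrite sum_sqr; under eq_bigr do rewrite mulrDl mul1r.
by rewrite big_split /= sum_cubic sum_quartic; ring.
Qed.

End CharacterSums.

Theorem theorem5p2 (p n : nat) (F : finFieldType)
    (p_prime : prime p) (p_odd : odd p) (n_gt0 : (0 < n)%N)
    (cardF : #|F| = (p ^ n)%N)
    (a b lambda : F) (a_neq0 : a != 0) (b_neq0 : b != 0)
    (def_lambda : lambda = a ^+ 2 / b)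
    (lambda_neq0 : lambda != 0) (lambda_neqN1 : lambda != -1) :
  psi24 a b =
    - phi (- b) * a_q lambda - phi (- a) * a_q (1 / lambda) - 1.
Proof.
have charFp : p \in [pchar F] := card_finPcharP cardF p_prime.
have two_neq0 : (2%:R : F) != 0.
  by rewrite -(dvdn_pcharf charFp) dvdn_prime2 //; case: eqP p_odd => // ->.
by rewrite def_lambda div1r invf_div psi24E.
Qed.
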